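(* Let $D=\sum_j a_j\{p_j\}+a\{\infty\}$ be an Arakelov divisor on $\overline{\mathrm{Spec}\,\mathbb{Z}}$, let $\lambda=e^a$ and consider the abelian group $L=H^0(\mathrm{Spec}\,\mathbb{Z},\mathcal{O}(D_{\mathrm{finite}}))\subset\mathbb{Q}\subset\mathbb{R}$. Then the functor $$\mathbf{H}(D):=(K_{L,\lambda}\times\mathrm{Id})\circ\gamma\circ\partial:\Delta^{\mathrm{op}}\longrightarrow\mathbb{S}\text{-Mod},$$ that is, $[n]\mapsto\big(k_+\mapsto K_{L,\lambda}(X_n\wedge k_+,Y_n\wedge k_+)\big)$ with $(X_n,Y_n)=\partial[n]^*$, defines a $\Gamma$-space that depends (up to isomorphism) only on the linear equivalence class of $D$.
   Context: Arakelov divisors: $D=\sum_j a_j\{p_j\}+a\{\infty\}$ is a finite formal sum, $p_j$ distinct primes, $a_j\in\mathbb{Z}$, $a\in\mathbb{R}$; $D_{\mathrm{finite}}=\sum_j a_j\{p_j\}$ and $L=H^0(\mathrm{Spec}\,\mathbb{Z},\mathcal{O}(D_{\mathrm{finite}}))=\{q\in\mathbb{Q}:|q|_{p_j}\le p_j^{a_j}\ \forall j,\ |q|_p\le1\text{ for all other primes }p\}$. For $q\in\mathbb{Q}_+^*$ the principal divisor is $(q)=\sum_p v_p(q)\{p\}-\log(q)\{\infty\}$; $D,D'$ are linearly equivalent if $D'=D+(q)$ for some $q$. $\Gamma^{\mathrm{op}}$ is the category of pointed sets $k_+=\{0,\dots,k\}$ (base point $0$) and pointed maps; $\mathbb{S}$-Mod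 is the category of pointed covariant functors $\Gamma^{\mathrm{op}}\to\mathfrak{Sets}_*$ (pointed sets); a $\Gamma$-space is a functor $\Delta^{\mathrm{op}}\to\mathbb{S}\text{-Mod}$, i.e. a simplicial object in $\mathbb{S}$-Mod. $\Delta^{\mathrm{op}}$ is identified with the category of finite intervals $[n]^*=\{0,\dots,n+1\}$ and non-decreasing maps preserving smallest and largest elements; the dual of $\theta\in\mathrm{Hom}_\Delta([n],[m])$ is $\theta^*:[m]^*\to[n]^*$ with $j\le\theta(i)\iff\theta^*(j)\le i$. $\mathfrak{Sets}_{2,*}$ is the category of pairs $(X,Y)$ of pointed sets, $*\in Y\subset X$, with morphisms the pointed maps $f:X\to X'$ with $f(Y)\subset Y'$. $\partial:\Delta^{\mathrm{op}}\to\mathfrak{Sets}_{2,*}$ sends an interval $I$ to $(X,Y)$, $X=I$ pointed by its smallest element, $Y=\{\text{smallest},\text{largest}\}$. $\gamma$ sends $(X,Y)$ to the functor $k_+\mapsto(X\wedge k_+,Y\wedge k_+)$ on $\Gamma^{\mathrm{op}}$; applying a functor $K$ to it pointwise is denoted $(K\times\mathrm{Id})\circ\gamma$. Let $\phi:\mathbb{R}\to\mathbb{R}/L$ be the quotient map. $H_\phi(X,Y)$ is the abelian group of (finitely supported) functions $\psi$ on $X\setminus\{*\}$ with $\psi(x)\in\mathbb{R}$ for $x\in X\setminus Y$ and $\psi(y)\in\mathbb{R}/L$ for $y\in Y\setminus\{*\}$ (base point $\psi=0$). For a morphism $f:(X,Y)\to(X',Y')$: $H_\phi(f)(\psi)(y)=\sum_{f(x)=y}\psi(x)$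 if $y\in X'\setminus Y'$, and $H_\phi(f)(\psi)(y)=\sum_{x\in X\setminus\{*\},f(x)=y}p(\psi(x))$ if $y\in Y'\setminus\{*\}$, where $p=\phi$ on $\mathbb{R}$-values and $p=\mathrm{id}$ on $\mathbb{R}/L$-values. $K_{L,\lambda}:\mathfrak{Sets}_{2,*}\to\mathfrak{Sets}_*$ is the subfunctor $K_{L,\lambda}(X,Y)=\{\psi\in H_\phi(X,Y):\sum_{x\in X\setminus Y}|\psi(x)|\le\lambda\}$. *)

(* Defs.v *)
From HB Require Import structures.
From mathcomp Require Import all_boot all_order all_algebra.
From mathcomp Require Import finmap all_classical all_reals all_analysis.
From mathcomp.multinomials Require Import freeg.
From mathcomp Require Import zify ring.

Set Implicit Arguments.
Unset Strict Implicit.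
Unset Printing Implicit Defensive.
Import Order.TTheory GRing.Theory Num.Theory.
Local Open Scope classical_set_scope.
Local Open Scope ring_scope.
Local Open Scope quotient_scope.

Record category := Category {
  obj : Type;
  hom : obj -> obj -> Type;
  idm : forall x, hom x x;
  compm : forall x y z, hom y z -> hom x y -> hom x z;
  comp1m : forall x y (f : hom x y), compm (idm y) f = f;
  compm1 : forall x y (f : hom x y), compm f (idm x) = f;
  compmA : forall x y z t (h : hom z t) (g : hom y z) (f : hom x y),
    compm h (compm g f) = compm (compm h g) f }.
Arguments idm {c} x.
Arguments compm {c x y z}.

Definition isomorphic (C : category) (x y : obj C) : Prop :=
  exists (f : hom x y) (g : hom y x), compm g f = idm x /\ compm f g = idm y.

Program Definition op (C : category) : category :=
  @Category (obj C) (fun x y => hom y x) idm (fun x y z g f => compm f g) _ _ _.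
Next Obligation. by move=> * /=; exact: compm1. Qed.
Next Obligation. by move=> * /=; exact: comp1m. Qed.
Next Obligation. by move=> * /=; rewrite compmA. Qed.

Program Definition full_subcat (C : category) (T : Type) (F : T -> obj C)
    : category :=
  @Category T (fun x y => hom (F x) (F y)) (fun x => idm (F x))
    (fun x y z => compm) _ _ _.
Next Obligation. by move=> * /=; exact: comp1m. Qed.
Next Obligation. by move=> * /=; exact: compm1. Qed.
Next Obligation. by move=> * /=; exact: compmA. Qed.

(* An assignment on objects and morphisms, with no functor laws. *)
Record functor_data (C D : category) := FunctorData {
  fobj :> obj C -> obj D;
  fmor : forall x y, hom x y -> hom (fobj x) (fobj y) }.
Arguments fmor {C D} f {x y}.

Record functor (C D : category) := Functor {
  fdata :> functor_data C D;
  fmor1 : forall x, fmor fdata (idm x) = idm (fdata x);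
  fmorM : forall x y z (g : hom y z) (f : hom x y),
    fmor fdata (compm g f) = compm (fmor fdata g) (fmor fdata f) }.

Definition fcomp_data (C D E : category) (G : functor_data D E)
    (F : functor_data C D) : functor_data C E :=
  FunctorData (fun x y f => fmor G (fmor F f)).

Record nat_trans (C D : category) (F G : functor_data C D) := NatTrans {
  nt :> forall x, hom (F x) (G x);
  ntP : forall x y (f : hom x y), compm (nt y) (fmor F f) = compm (fmor G f) (nt x) }.

Lemma nat_transP (C D : category) (F G : functor_data C D)
  (a b : nat_trans F G) : (forall x, a x = b x) -> a = b.
Proof.
case: a b => a aP [b bP] /= ab.
have {}ab : a = b by apply: functional_extensionality_dep.
by move: aP; rewrite ab => aP; congr NatTrans; apply: Prop_irrelevance.
Qed.

Program Definition functor_cat (C D : category) : category :=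
  @Category (functor C D) (fun F G => nat_trans F G)
    (fun F => @NatTrans _ _ F F (fun x => idm (F x)) _)
    (fun F G H b a => @NatTrans _ _ F H (fun x => compm (b x) (a x)) _) _ _ _.
Next Obligation. by move=> * /=; rewrite comp1m compm1. Qed.
Next Obligation. by move=> * /=; rewrite -compmA ntP compmA ntP compmA. Qed.
Next Obligation. by move=> * /=; apply: nat_transP => x; apply: comp1m. Qed.
Next Obligation. by move=> * /=; apply: nat_transP => x; apply: compm1. Qed.
Next Obligation. by move=> * /=; apply: nat_transP => z; apply: compmA. Qed.

(* The category of lawless assignments C -> D and families of morphisms with no
   naturality condition; it allows a composite of constructions with values in
   functors to be written down before any functoriality is known. *)
Program Definition prefunctor_cat (C D : category) : category :=
  @Category (functor_data C D) (fun F G => forall x, hom (F x) (G x))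
    (fun F x => idm (F x)) (fun F G H b a x => compm (b x) (a x)) _ _ _.
Next Obligation. by move=> * /=; apply: functional_extensionality_dep => z; apply: comp1m. Qed.
Next Obligation. by move=> * /=; apply: functional_extensionality_dep => z; apply: compm1. Qed.
Next Obligation. by move=> * /=; apply: functional_extensionality_dep => u; apply: compmA. Qed.

Definition postcomp_data (A C D : category) (K : functor_data C D)
    : functor_data (prefunctor_cat A C) (prefunctor_cat A D) :=
  @FunctorData (prefunctor_cat A C) (prefunctor_cat A D)
    (fun F => fcomp_data K F) (fun F G a x => fmor K (a x)).

Record pmap (X Y : pointedType) := PMap {
  pfun :> X -> Y;
  pfunP : pfun point = point }.

Lemma pmapP (X Y : pointedType) (f g : pmap X Y) : f =1 g -> f = g.
Proof.
case: f g => f fP [g gP] /= fg.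
have {}fg : f = g by apply/funext.
by move: fP; rewrite fg => fP; congr PMap; apply: Prop_irrelevance.
Qed.

Definition pmap_id (X : pointedType) : pmap X X := PMap (erefl : idfun point = point).

Program Definition pmap_comp (X Y Z : pointedType) (g : pmap Y Z) (f : pmap X Y)
  : pmap X Z := @PMap _ _ (g \o f) _.
Next Obligation. by move=> * /=; rewrite /= !pfunP. Qed.

Program Definition Sets_pt : category :=
  @Category pointedType pmap pmap_id pmap_comp _ _ _.
Next Obligation. by move=> * /=; exact: pmapP. Qed.
Next Obligation. by move=> * /=; exact: pmapP. Qed.
Next Obligation. by move=> * /=; exact: pmapP. Qed.

HB.instance Definition _ n := isPointed.Build 'I_n.+1 ord0.

(* k_+ = {0, ..., k} with base point 0 *)
Definition kplus (k : nat) : pointedType := 'I_k.+1.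

Definition Gamma_op : category := @full_subcat Sets_pt nat kplus.

(* Functors to pointed sets are pointed when they send the zero object 0_+ to a
   one-point set. *)
Record smodule := SModule {
  smod_fun :> functor Gamma_op Sets_pt;
  smod_pointed : forall x : (smod_fun 0%N : pointedType), x = point }.

Definition SMod : category :=
  @full_subcat (functor_cat Gamma_op Sets_pt) smodule smod_fun.

Definition SMod_data : functor_data SMod (prefunctor_cat Gamma_op Sets_pt) :=
  @FunctorData SMod (prefunctor_cat Gamma_op Sets_pt)
    (fun M => fdata (smod_fun M)) (fun M N a => nt a).

Record mono_map (n m : nat) := MonoMap {
  mfun :> 'I_n.+1 -> 'I_m.+1;
  mfunP : forall i j : 'I_n.+1, (i <= j)%N -> (mfun i <= mfun j)%N }.

Lemma mono_mapP n m (f g : mono_map n m) : f =1 g -> f = g.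
Proof.
case: f g => f fP [g gP] /= fg.
have {}fg : f = g by apply/funext.
by move: fP; rewrite fg => fP; congr MonoMap; apply: Prop_irrelevance.
Qed.

Program Definition Delta : category :=
  @Category nat mono_map (fun n => @MonoMap n n idfun _)
    (fun n m l g f => @MonoMap n l (g \o f) _) _ _ _.
Next Obligation. by []. Qed.
Next Obligation. by move=> * /=; do 2!apply: mfunP. Qed.
Next Obligation. by move=> * /=; exact: mono_mapP. Qed.
Next Obligation. by move=> * /=; exact: mono_mapP. Qed.
Next Obligation. by move=> * /=; exact: mono_mapP. Qed.

(* Morphisms [n]^* -> [m]^* of finite intervals, [n]^* = {0, ..., n+1}. *)
Record interval_map (n m : nat) := IntervalMap {
  ifun :> mono_map n.+1 m.+1;
  ifun0 : ifun ord0 = ord0;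
  ifun_max : ifun ord_max = ord_max }.

Lemma interval_mapP n m (f g : interval_map n m) : f =1 g -> f = g.
Proof.
case: f g => f f0 f1 [g g0 g1] /= /mono_mapP fg.
move: f0 f1; rewrite fg => f0 f1; congr IntervalMap; exact: Prop_irrelevance.
Qed.

Program Definition Intervals : category :=
  @Category nat interval_map
    (fun n => @IntervalMap n n (@idm Delta n.+1) _ _)
    (fun n m l g f => @IntervalMap n l
       (@compm Delta n.+1 m.+1 l.+1 (ifun g) (ifun f)) _ _) _ _ _.
Next Obligation. by []. Qed.
Next Obligation. by []. Qed.
Next Obligation. by move=> * /=; rewrite /= !ifun0. Qed.
Next Obligation. by move=> * /=; rewrite /= !ifun_max. Qed.
Next Obligation. by move=> * /=; exact: interval_mapP. Qed.
Next Obligation. by move=> * /=; exact: interval_mapP. Qed.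
Next Obligation. by move=> * /=; exact: interval_mapP. Qed.

(* theta^* (j) is the number of i in [n] with theta (i) < j; dual_funP is the
   property j <= theta (i) <-> theta^* (j) <= i that characterizes it. *)
Section Dual.
Variables (n m : nat) (theta : mono_map n m).

Definition dual_fun (j : 'I_m.+2) : 'I_n.+2 :=
  inord #|[pred i : 'I_n.+1 | (theta i < j)%N]|.

Lemma dual_funE j : dual_fun j = #|[pred i : 'I_n.+1 | (theta i < j)%N]| :> nat.
Proof. by rewrite inordK // ltnS -[leqRHS]card_ord max_card. Qed.

Lemma dual_funP (i : 'I_n.+1) (j : 'I_m.+2) :
  (j <= theta i)%N = (dual_fun j <= i)%N.
Proof.
rewrite dual_funE; apply/idP/idP => [jt|].
  rewrite -[leqRHS](@size_iota 0) cardE -(size_map val).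
  apply: uniq_leq_size; first by rewrite map_inj_uniq ?enum_uniq //; exact: val_inj.
  move=> _ /mapP[k + ->]; rewrite mem_enum inE mem_iota /= => tk.
  rewrite add0n ltnNge; apply/negP => ik.
  by have := leq_trans jt (mfunP theta ik); rewrite leqNgt tk.
apply: contraTT; rewrite -!ltnNge => tj.
rewrite -[i.+1](size_iota 0) cardE -(size_map val).
apply: uniq_leq_size; first exact: iota_uniq.
move=> k; rewrite mem_iota /= add0n => ki.
have kn : (k < n.+1)%N by apply: leq_trans ki _; exact: ltn_ord.
apply/mapP; exists (Ordinal kn) => //; rewrite mem_enum inE /=.
by apply: leq_ltn_trans tj; exact: mfunP.
Qed.

Program Definition dual_map : interval_map m n :=
  @IntervalMap m n (@MonoMap m.+1 n.+1 dual_fun _) _ _.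
Next Obligation.
move=> i j ij; rewrite !dual_funE; apply: subset_leq_card; apply/fintype.subsetP => k.
by rewrite !inE => /leq_trans; apply.
Qed.
Next Obligation. by move=> * /=; apply: val_inj; rewrite /= dual_funE eq_card0. Qed.
Next Obligation.
apply: val_inj; rewrite /= dual_funE -[RHS]card_ord; apply: eq_card => i.
by rewrite !inE ltn_ord.
Qed.

End Dual.

Definition dual_data : functor_data (op Delta) Intervals :=
  @FunctorData (op Delta) Intervals (fun n => n) (fun m n theta => dual_map theta).

Record pointed_pair := PointedPair {
  pspace :> pointedType;
  psub : set pspace;
  psub_point : psub point }.

Record pair_map (P Q : pointed_pair) := PairMap {
  pmap_of :> pmap P Q;
  pair_mapP : forall y, psub y -> psub (pmap_of y) }.

Lemma pair_map_eq (P Q : pointed_pair) (f g : pair_map P Q) : f =1 g -> f = g.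
Proof.
case: f g => f fP [g gP] /= /pmapP fg.
by move: fP; rewrite fg => fP; congr PairMap; apply: Prop_irrelevance.
Qed.

Program Definition Sets2_pt : category :=
  @Category pointed_pair pair_map
    (fun P => @PairMap P P (pmap_id P) _)
    (fun P Q S g f => @PairMap P S (pmap_comp g f) _) _ _ _.
Next Obligation. by []. Qed.
Next Obligation. by move=> * /=; do 2!apply: pair_mapP. Qed.
Next Obligation. by move=> * /=; exact: pair_map_eq. Qed.
Next Obligation. by move=> * /=; exact: pair_map_eq. Qed.
Next Obligation. by move=> * /=; exact: pair_map_eq. Qed.

Program Definition boundary_pair (n : nat) : pointed_pair :=
  @PointedPair 'I_n.+2 [set ord0; ord_max] _.
Next Obligation. by move=> * /=; left. Qed.

Program Definition boundary_map n m (f : interval_map n m)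
  : pair_map (boundary_pair n) (boundary_pair m) :=
  @PairMap (boundary_pair n) (boundary_pair m)
    (@PMap (boundary_pair n) (boundary_pair m) f (ifun0 f)) _.
Next Obligation.
move=> n m f x [] ->; [left; exact: ifun0|right; exact: ifun_max].
Qed.

Definition boundary_data : functor_data Intervals Sets2_pt :=
  @FunctorData Intervals Sets2_pt boundary_pair boundary_map.

(* A /\ B is A * B with the wedge of A and B collapsed to the base point. *)
Section Smash.
Variables A B : pointedType.

Definition in_wedge (u : A * B) := (u.1 == point) || (u.2 == point).
Definition smash_rel (u v : A * B) := (u == v) || (in_wedge u && in_wedge v).

Lemma smash_rel_equiv : equiv_class_of smash_rel.
Proof.
split=> [u|u v|v u w]; rewrite /smash_rel ?eqxx //.
  by rewrite eq_sym andbC.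
case/orP=> [/eqP->//|/andP[wu wv]] /orP[/eqP<-|/andP[_ ww]].
  by rewrite wu wv orbT.
by rewrite wu ww orbT.
Qed.

Canonical smash_equivRel := EquivRelPack smash_rel_equiv.
Canonical smash_encModRel := defaultEncModRel smash_rel.

Definition smash := {eq_quot smash_rel}.

HB.instance Definition _ : EqQuotient (A * B)%type smash_rel smash :=
  EqQuotient.on smash.
HB.instance Definition _ := Choice.on smash.
HB.instance Definition _ := isPointed.Build smash (\pi_smash (point, point)).

Lemma smash_piP u v : reflect (\pi_smash u = \pi_smash v) (smash_rel u v).
Proof. by apply: (iffP idP) => [?|/eqP]; [apply/eqP|]; rewrite ?eqmodE. Qed.

End Smash.

Section SmashMap.
Variables (A B A' B' : pointedType) (f : pmap A A') (g : pmap B B').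

Definition smash_fun (z : smash A B) : smash A' B' :=
  \pi_(smash A' B') (f (repr z).1, g (repr z).2).

Lemma smash_funE u : smash_fun (\pi_(smash A B) u) = \pi_(smash A' B') (f u.1, g u.2).
Proof.
have /smash_piP : \pi_(smash A B) (repr (\pi_(smash A B) u)) = \pi_(smash A B) u.
  by rewrite reprK.
rewrite /smash_fun; set v := repr _ => /orP[/eqP->//|/andP[wv wu]].
have wfg w : in_wedge w -> in_wedge (f w.1, g w.2).
  by rewrite /in_wedge => /orP[/eqP->|/eqP->] /=; rewrite pfunP eqxx ?orbT.
by apply/smash_piP; rewrite /smash_rel !wfg // orbT.
Qed.

Program Definition smash_map : pmap (smash A B) (smash A' B') :=
  @PMap _ _ smash_fun _.
Next Obligation.
by rewrite [LHS](smash_funE (point, point)) /= !pfunP.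
Qed.

End SmashMap.

Program Definition smash_pair (P : pointed_pair) (B : pointedType) : pointed_pair :=
  @PointedPair (smash P B)
    [set \pi_(smash P B) (y, b) | y in psub (p := P) & b in [set: B]] _.
Next Obligation. by move=> * /=; exists point; [exact: psub_point|exists point]. Qed.

Program Definition smash_pair_map (P Q : pointed_pair) (B C : pointedType)
    (f : pair_map P Q) (g : pmap B C) : pair_map (smash_pair P B) (smash_pair Q C) :=
  @PairMap (smash_pair P B) (smash_pair Q C) (smash_map f g) _.
Next Obligation.
move=> P Q B C f g _ [z Pz [b _ <-]].
exists (f z); first exact: pair_mapP.
by exists (g b) => //; rewrite [RHS](smash_funE _ _ (z, b)).
Qed.

Definition gamma_data : functor_data Sets2_pt (prefunctor_cat Gamma_op Sets2_pt) :=
  @FunctorData Sets2_pt (prefunctor_cat Gamma_op Sets2_pt)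
    (fun P => @FunctorData Gamma_op Sets2_pt (fun k => smash_pair P (kplus k))
       (fun k l g => smash_pair_map (@idm Sets2_pt P) g))
    (fun P Q f k => smash_pair_map f (pmap_id (kplus k))).

Section Hphi.
Variables (R : realType) (L : zmodClosed R).

Definition RmodL : zmodType := Quotient.quot L.
Definition phi : R -> RmodL := \pi_(Quotient.quot L).

(* psi is split into its R-valued restriction to X \ Y and its R/L-valued
   restriction to Y \ {*}, each extended by 0 to the whole of X. *)
Record Hphi_fun (P : pointed_pair) := HphiFun {
  realpart : P -> R;
  modpart : P -> RmodL;
  realpart_out : forall x, psub x -> realpart x = 0;
  modpart_out : forall x, ~ (psub x /\ x <> point) -> modpart x = 0;
  realpart_fin : finite_set [set x | realpart x != 0];
  modpart_fin : finite_set [set x | modpart x != 0] }.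

Lemma Hphi_fun_eq (P : pointed_pair) (u v : Hphi_fun P) :
  realpart u =1 realpart v -> modpart u =1 modpart v -> u = v.
Proof.
case: u v => a b a1 b1 a2 b2 [c d c1 d1 c2 d2] /= /funext ac /funext bd.
subst c d; congr HphiFun; exact: Prop_irrelevance.
Qed.

Program Definition Hphi_zero (P : pointed_pair) : Hphi_fun P :=
  @HphiFun P (fun=> 0) (fun=> 0) _ _ _ _.
Next Obligation. by []. Qed.
Next Obligation. by []. Qed.
Next Obligation.
move=> P; rewrite (_ : [set _ | _] = set0) //.
by apply/seteqP; split=> x //=; rewrite eqxx.
Qed.
Next Obligation.
move=> P; rewrite (_ : [set _ | _] = set0) //.
by apply/seteqP; split=> x //=; rewrite eqxx.
Qed.

HB.instance Definition _ (P : pointed_pair) := gen_eqMixin (Hphi_fun P).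
HB.instance Definition _ (P : pointed_pair) := gen_choiceMixin (Hphi_fun P).
HB.instance Definition _ (P : pointed_pair) :=
  isPointed.Build (Hphi_fun P) (Hphi_zero P).

Definition to_mod (P : pointed_pair) (psi : Hphi_fun P) (x : P) : RmodL :=
  if `[< psub x >] then modpart psi x else phi (realpart psi x).

Section Map.
Variables (P Q : pointed_pair) (f : pair_map P Q) (psi : Hphi_fun P).

Definition push_real (y : Q) : R :=
  if `[< psub y >] then 0 else \sum_(x \in [set x : P | f x = y]) realpart psi x.

Definition push_mod (y : Q) : RmodL :=
  if `[< psub y /\ y <> point >]
  then \sum_(x \in [set x : P | x <> point /\ f x = y]) to_mod psi x
  else 0.

Program Definition Hphi_push : Hphi_fun Q := @HphiFun Q push_real push_mod _ _ _ _.
Next Obligation. by move=> y Yy; rewrite /push_real asboolT. Qed.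
Next Obligation. by move=> y Yy; rewrite /push_mod asboolF. Qed.
Next Obligation.
apply: (@sub_finite_set _ _ (f @` [set x | realpart psi x != 0])); last first.
  by apply: finite_image; exact: realpart_fin.
move=> y /=; rewrite /push_real; case: ifP => _; first by rewrite eqxx.
apply: contra_neqP => nE; apply: fsbig1 => x /= fxy.
by apply/eqP/negPn/negP => ux; apply: nE; exists x.
Qed.
Next Obligation.
apply: (@sub_finite_set _ _
  (f @` ([set x | realpart psi x != 0] `|` [set x | modpart psi x != 0]))); last first.
  apply: finite_image; rewrite finite_setU; split.
    exact: realpart_fin.
  exact: modpart_fin.
move=> y /=; rewrite /push_mod; case: ifP => _; last by rewrite eqxx.
apply: contra_neqP => nE; apply: fsbig1 => x /= [_ fxy].
rewrite /to_mod; case: ifP => _.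
  by apply/eqP/negPn/negP => ux; apply: nE; exists x => //; right.
have -> : realpart psi x = 0.
  by apply/eqP/negPn/negP => ux; apply: nE; exists x => //; left.
by rewrite /phi raddf0.
Qed.

End Map.

Lemma Hphi_push0 (P Q : pointed_pair) (f : pair_map P Q) :
  Hphi_push f point = point.
Proof.
apply: Hphi_fun_eq => y /=; rewrite ?/push_real ?/push_mod; case: ifP => // _.
  by apply: fsbig1.
by apply: fsbig1 => x _; rewrite /to_mod /= /phi raddf0 if_same.
Qed.

Definition Hphi_data : functor_data Sets2_pt Sets_pt :=
  @FunctorData Sets2_pt Sets_pt (fun P => Hphi_fun P : pointedType)
    (fun P Q f => PMap (Hphi_push0 f)).

Definition Hphi_norm (P : pointed_pair) (psi : Hphi_fun P) : R :=
  \sum_(x \in ~` psub (p := P)) `|realpart psi x|.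

Lemma Hphi_norm0 (P : pointed_pair) : Hphi_norm (point : Hphi_fun P) = 0.
Proof. by apply: fsbig1 => x _; rewrite normr0. Qed.

Lemma Hphi_normE (P : pointed_pair) (psi : Hphi_fun P) (r : {fset P}) :
  (forall x, x \notin r -> realpart psi x = 0) ->
  Hphi_norm psi = \sum_(x <- r) `|realpart psi x|.
Proof.
move=> ur; rewrite /Hphi_norm (fsbig_widen _ setT) //.
  by rewrite (fsbigTE r) // => x /ur ->; rewrite normr0.
by move=> x [_ /= /contrapT /(realpart_out psi) ->]; rewrite normr0.
Qed.

Lemma Hphi_norm_push (P Q : pointed_pair) (f : pair_map P Q) (psi : Hphi_fun P) :
  Hphi_norm (Hphi_push f psi) <= Hphi_norm psi.
Proof.
have /finite_fsetP[r rE] := realpart_fin psi.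
have ur x : x \notin r -> realpart psi x = 0.
  move=> xr; apply/eqP/negPn/negP => ux; move/negP: xr; apply.
  by have : [set x | realpart psi x != 0] x by []; rewrite rE.
have push_le y :
    `|push_real f psi y| <= \sum_(x <- r | f x == y) `|realpart psi x|.
  rewrite /push_real; case: ifP => _; first by rewrite normr0 sumr_ge0.
  rewrite (_ : \sum_(x \in _) _ = \sum_(x <- r | f x == y) realpart psi x).
    exact: ler_norm_sum.
  rewrite [RHS]bigfs ?fset_uniq //; last by move=> x _; exact: ur.
  by apply: eq_fsbigl; apply/seteqP; split=> x /= /eqP.
rewrite (Hphi_normE ur) (@Hphi_normE _ _ [fset f x | x in r]%fset); last first.
  move=> y yr; apply/eqP; rewrite -normr_le0; apply: le_trans (push_le y) _.
  rewrite big_seq_cond big_pred0 // => x; apply/negP => /andP[xr /eqP fxy].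
  by move/negP: yr; apply; apply/imfsetP; exists x.
apply: le_trans (ler_sum _ (fun y _ => push_le y)) _.
rewrite (exchange_big_dep predT) //= big_seq [leRHS]big_seq.
apply: ler_sum => x xr; rewrite -big_filter.
rewrite (_ : [seq _ <- _ | _] = [:: f x]) ?big_seq1 //.
rewrite (eq_filter (a2 := pred1 (f x))) ?filter_pred1_uniq ?fset_uniq //.
by apply/imfsetP; exists x.
by move=> y; rewrite /= eq_sym.
Qed.

Variable lam : {nonneg R}.

Definition KL_fun (P : pointed_pair) :=
  {psi : Hphi_fun P | Hphi_norm psi <= lam%:num}.

Program Definition KL_zero (P : pointed_pair) : KL_fun P := exist _ point _.
Next Obligation. by move=> P /=; rewrite Hphi_norm0. Qed.

HB.instance Definition _ (P : pointed_pair) := Choice.on (KL_fun P).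
HB.instance Definition _ (P : pointed_pair) :=
  isPointed.Build (KL_fun P) (KL_zero P).

Program Definition KL_push (P Q : pointed_pair) (f : pair_map P Q)
  (psi : KL_fun P) : KL_fun Q := exist _ (Hphi_push f (val psi)) _.
Next Obligation.
by move=> P Q f [psi /= psiP]; apply: le_trans psiP; exact: Hphi_norm_push.
Qed.

Lemma KL_push0 (P Q : pointed_pair) (f : pair_map P Q) : KL_push f point = point.
Proof. by apply: val_inj; exact: Hphi_push0. Qed.

Definition KL_data : functor_data Sets2_pt Sets_pt :=
  @FunctorData Sets2_pt Sets_pt (fun P => KL_fun P : pointedType)
    (fun P Q f => PMap (KL_push0 f)).

End Hphi.

Definition prime_nat := {p : nat | prime p}.

Definition vp (p : prime_nat) (q : rat) : int :=
  (logn (val p) `|numq q|)%:Z - (logn (val p) `|denq q|)%:Z.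

Definition padic_abs (p : prime_nat) (q : rat) : rat :=
  if q == 0 then 0 else (val p)%:R ^ (- vp p q).

Definition arakelov_divisor (R : realType) : zmodType :=
  ({freeg prime_nat / int} * R)%type.

(* The family p |-> v_p(q) {p} has finite support when q != 0. *)
Definition principal_divisor (R : realType) (q : rat) : arakelov_divisor R :=
  (\sum_(p \in [set: prime_nat]) << vp p q *g p >>, - ln (ratr q)).

Definition linearly_equivalent (R : realType) (D D' : arakelov_divisor R) : Prop :=
  exists2 q : rat, 0 < q & D' = D + principal_divisor R q.

(* For p outside the support of D the bound is p ^ 0 = 1. *)
Definition H0_finite (D : {freeg prime_nat / int}) : set rat :=
  [set q | forall p : prime_nat, padic_abs p q <= (val p)%:R ^ coeff p D].

Lemma vp_frac (p : prime_nat) (n d : int) : n != 0 -> d != 0 ->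
  vp p (n%:~R / d%:~R) = (logn (val p) `|n|)%:Z - (logn (val p) `|d|)%:Z.
Proof.
move=> n0 d0; set q := n%:~R / d%:~R : rat.
have q0 : numq q != 0.
  by rewrite numq_eq0 /q mulf_eq0 invr_eq0 !intr_eq0 negb_or n0.
have : (numq q * d = n * denq q)%R.
  apply/eqP; rewrite -(eqr_int rat) !rmorphM /=; apply/eqP.
  have d0' : d%:~R != 0 :> rat by rewrite intr_eq0.
  have e0' : (denq q)%:~R != 0 :> rat by rewrite intr_eq0 denq_neq0.
  have : (numq q)%:~R / (denq q)%:~R = n%:~R / d%:~R :> rat.
    exact: divq_num_den.
  by move/eqP; rewrite eqr_div // => /eqP.
move=> /(congr1 (fun z : int => logn (val p) `|z|%N)).
rewrite !abszM !lognM ?absz_gt0 ?denq_neq0 // /vp => /eqP.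
rewrite -eqz_nat !PoszD => /eqP; lia.
Qed.

Lemma padic_abs_leP (p : prime_nat) (q : rat) (k : int) :
  (padic_abs p q <= (val p)%:R ^ k) = ((q == 0) || (0 <= vp p q + k)).
Proof.
have p1 : 1 < (val p)%:R :> rat by rewrite ltr1n prime_gt1 // (valP p).
rewrite /padic_abs; case: eqP => _ /=; first by rewrite exprz_ge0 // ler0n.
by rewrite ler_eXz2l //; apply/idP/idP; lia.
Qed.

Lemma vpB (p : prime_nat) (q r : rat) (k : int) : q != 0 -> r != 0 -> q - r != 0 ->
  0 <= vp p q + k -> 0 <= vp p r + k -> 0 <= vp p (q - r) + k.
Proof.
move=> q0 r0 qr0; rewrite -[q]divq_num_den -[r]divq_num_den.
set a := numq q; set b := denq q; set c := numq r; set d := denq r.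
have [b0 d0] : b != 0 /\ d != 0 by rewrite !denq_neq0.
have [a0 c0] : a != 0 /\ c != 0 by rewrite !numq_eq0.
have E : a%:~R / b%:~R - c%:~R / d%:~R = (a * d - c * b)%:~R / (b * d)%:~R :> rat.
  by rewrite rmorphB !rmorphM /=; field; rewrite !intr_eq0 d0 b0.
have n0 : a * d - c * b != 0.
  apply: contra_neq qr0 => n0.
  by rewrite -[q]divq_num_den -[r]divq_num_den E n0 mul0r.
rewrite E !vp_frac ?mulf_neq0 // abszM lognM ?absz_gt0 //.
have H (e : nat) : (e <= logn (val p) `|(a * d)%R|)%N ->
    (e <= logn (val p) `|(c * b)%R|)%N -> (e <= logn (val p) `|(a * d - c * b)%R|)%N.
  rewrite -!pfactor_dvdn ?(valP p) ?absz_gt0 ?mulf_neq0 // => h1 h2.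
  have : (((val p) ^ e)%N%:Z %| a * d - c * b)%Z by rewrite rpredB.
  by [].
move: (H); rewrite !abszM !lognM ?absz_gt0 // => {}H.
set x := logn _ `|a| in H *; set y := logn _ `|b| in H *.
set z := logn _ `|c| in H *; set w := logn _ `|d| in H *.
set t := logn _ _ in H *.
move=> h1 h2.
have := H (minn (x + w) (z + y)) (geq_minl _ _) (geq_minr _ _).
lia.
Qed.

Section H0real.
Variables (R : realType) (D : {freeg prime_nat / int}).

(* H0_finite D as a subgroup of R *)
Definition H0R : {pred R} := [pred x | `[< exists2 q, H0_finite D q & x = ratr q >]].

Lemma H0R_zmod_closed : zmod_closed H0R.
Proof.
split.
  apply/asboolP; exists 0; last by rewrite rmorph0.
  by move=> p; rewrite padic_abs_leP eqxx.
move=> _ _ /asboolP[q Hq ->] /asboolP[r Hr ->]; apply/asboolP.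
exists (q - r); last by rewrite rmorphB.
move=> p; move: (Hq p) (Hr p); rewrite !padic_abs_leP.
have [->|q0] /= := eqVneq q 0; have [->|r0] /= := eqVneq r 0;
  rewrite ?subr0 ?sub0r ?oppr_eq0 ?eqxx ?(negPf q0) ?(negPf r0) //=.
  by rewrite /vp numqN denqN abszN.
by have [//|qr0] /= := eqVneq (q - r) 0; exact: vpB.
Qed.

HB.instance Definition _ := GRing.isZmodClosed.Build R H0R H0R_zmod_closed.

Definition Lsub : zmodClosed R := H0R.

End H0real.

(* (K_{L,lambda} x Id) o gamma o boundary, precomposed with the identification
   dual_data of op Delta with the category of finite intervals; that it satisfies
   the laws making it a Gamma-space is not part of the definition. *)
Definition HD_data (R : realType) (D : arakelov_divisor R)
  : functor_data (op Delta) (prefunctor_cat Gamma_op Sets_pt) :=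
  fcomp_data (postcomp_data Gamma_op (KL_data (Lsub R D.1) (expR D.2)%:nng))
    (fcomp_data gamma_data (fcomp_data boundary_data dual_data)).

Definition Gamma_spaces : category := functor_cat (op Delta) SMod.

(* The assignments on objects and morphisms underlying a Gamma-space *)
Definition Gamma_space_data (G : obj Gamma_spaces)
  : functor_data (op Delta) (prefunctor_cat Gamma_op Sets_pt) :=
  fcomp_data SMod_data (G : functor _ _).

(* Main.v *)
From HB Require Import structures.
Require Import Defs.
From mathcomp Require Import all_boot all_order all_algebra.
From mathcomp Require Import finmap zify.
From mathcomp.multinomials Require Import freeg.
From mathcomp Require Import all_classical all_reals all_analysis.

(** Everything takes place at the level of functors K from pairs of pointed
    sets to pointed sets.

    If K sends one-point pairs to one-point sets, then the smash product and
    the simplicial interval with its boundary turn K into a Gamma-space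
    ([Gamma_space_of]): both constructions are functorial, the smash product
    separately in its two arguments, and X /\ 0_+ is a point.  This
    construction is itself functorial in K, so isomorphic functors give
    isomorphic Gamma-spaces ([isomorphic_Gamma_space_of]).

    Two facts about K_{L,lambda} then remain.  First, it is a functor
    ([KL_functor]).  The functions psi are pushed forward by summation over
    fibres, and the point is that at every y other than the base point the
    image of f_* psi in R/L is the sum over the fibre of f of the images of psi
    ([to_mod_push]), whether y lies in Y' or not: phi is additive, and a point
    outside Y' has its whole fibre outside Y.  Compatibility with composition
    is then the summation of a sum fibre by fibre ([fsum_fsum_fiber]).

    Second, its isomorphism class only depends on (L, lambda) up to
    homothety: if c > 0, multiplication by c induces an isomorphism from
    K_{L,lambda} to K_{cL,c lambda} ([isomorphic_KL_functor]), because it maps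
    R/L onto R/cL and multiplies the norm by c.  Replacing D by D + (q) replaces
    L by q^-1 L ([Lsub_add_principal]), since v_p (q r) = v_p (q) + v_p (r), and
    lambda = e^a by e^(a - log q) = q^-1 lambda, so that c = q^-1 gives the
    invariance under linear equivalence. *)

Set Implicit Arguments.
Unset Strict Implicit.
Unset Printing Implicit Defensive.
Import Order.TTheory GRing.Theory Num.Theory.
Local Open Scope classical_set_scope.
Local Open Scope ring_scope.
Local Open Scope quotient_scope.

(** * Sums of finite support *)

Section FiniteSupport.
Variables (I : choiceType) (U : zmodType).
Implicit Type F : I -> U.

Lemma finite_suppP F : finite_set [set x | F x != 0] ->
  exists r : {fset I}, forall x, x \notin r -> F x = 0.
Proof.
move=> /finite_fsetP[r rE]; exists r => x xr; apply/eqP/negPn/negP => Fx.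
by move/negP: xr; apply; have : [set x | F x != 0] x by []; rewrite rE.
Qed.

Lemma fsum_seq F (P : set I) (r : {fset I}) : (forall x, x \notin r -> F x = 0) ->
  \sum_(x \in P) F x = \sum_(x <- r | `[< P x >]) F x.
Proof.
move=> Fr; rewrite [RHS]bigfs ?fset_uniq //; last by move=> x _; exact: Fr.
by apply: eq_fsbigl; apply/seteqP; split=> x /=; move/asboolP.
Qed.

End FiniteSupport.

Lemma raddf_fsum (I : choiceType) (U V : zmodType) (h : {additive U -> V})
    (F : I -> U) (P : set I) :
  finite_set [set x | F x != 0] ->
  h (\sum_(x \in P) F x) = \sum_(x \in P) h (F x).
Proof.
move=> /finite_suppP[r Fr].
rewrite (fsum_seq _ Fr) (@fsum_seq _ _ (h \o F) _ r) ?raddf_sum // => x /Fr /= ->.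
by rewrite raddf0.
Qed.

(** A double sum over the fibres above Q is a single sum over the preimage of Q:
    the reason why pushing forward along g after f is pushing forward along g f. *)
Lemma fsum_fsum_fiber (U : zmodType) (I J : choiceType) (f : I -> J) (F : I -> U)
    (Q : set J) : finite_set [set x | F x != 0] ->
  \sum_(y \in Q) \sum_(x \in [set x | f x = y]) F x
  = \sum_(x \in [set x | Q (f x)]) F x.
Proof.
move=> /finite_suppP[r Fr]; rewrite (fsum_seq _ Fr).
under eq_fsbigr do rewrite (fsum_seq _ Fr).
rewrite (@fsum_seq _ _ _ _ [fset f x | x in r]%fset); last first.
  move=> y yr; rewrite big_seq_cond big_pred0 // => x; apply/negP => /andP[xr].
  by move=> /asboolP fxy; move/negP: yr; apply; apply/imfsetP; exists x.
(* Each x in the preimage occurs exactly once, in the fibre above f x. *)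
rewrite (exchange_big_dep (fun x => `[< Q (f x) >])) /=; last first.
  by move=> y x /asboolP Qy /asboolP fxy; apply/asboolP; rewrite fxy.
rewrite big_seq_cond [RHS]big_seq_cond; apply: eq_bigr => x /andP[xr /asboolP Qfx].
rewrite -big_filter (_ : [seq _ <- _ | _] = [:: f x]) ?big_seq1 //.
rewrite (eq_filter (a2 := pred1 (f x))) ?filter_pred1_uniq ?fset_uniq //.
  by apply/imfsetP; exists x.
move=> y /=; apply/andP/eqP => [[_ /asboolP]//|->].
by split; apply/asboolP.
Qed.

(** * Intervals, boundaries and smash products as functors *)

(** Transparent, so that the underlying assignments of the composites below
    compute to the composites of assignments. *)
Definition fcomp (C D E : category) (G : functor D E) (F : functor C D) : functor C E.
Proof.
refine (@Functor C E (fcomp_data G F) _ _) => /= [x|x y z g f].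
  by rewrite !fmor1.
by rewrite !fmorM.
Defined.

(** The Galois relation between theta and theta^* bounds theta^* (j) by elements
    of [n] only; that is enough to determine it, the value n + 1 being the one
    that no element of [n] bounds. *)
Lemma ord_le_inj n (a b : 'I_n.+2) :
  (forall i : 'I_n.+1, (a <= i)%N = (b <= i)%N) -> a = b.
Proof.
wlog ab : a b / (a <= b)%N => [hw H|H].
  by have [/hw->|/ltnW/hw->] := leqP a b.
apply: val_inj; apply/eqP; rewrite eqn_leq ab /= leqNgt; apply/negP => lt_ab.
have an : (a < n.+1)%N by apply: leq_trans lt_ab _; rewrite -ltnS ltn_ord.
by have := H (Ordinal an); rewrite /= leqnn leqNgt lt_ab.
Qed.

Lemma dual_map_id n : dual_map (idm (n : obj Delta)) = idm (n : obj Intervals).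
Proof.
by apply: interval_mapP => j; apply: ord_le_inj => i; rewrite -dual_funP.
Qed.

Lemma dual_map_comp n m l (g : mono_map m l) (f : mono_map n m) :
  dual_map (compm (c := Delta) g f)
  = compm (c := Intervals) (dual_map f) (dual_map g).
Proof.
by apply: interval_mapP => j; apply: ord_le_inj => i /=; rewrite -!dual_funP.
Qed.

Program Definition dual_functor : functor (op Delta) Intervals :=
  @Functor _ _ dual_data dual_map_id _.
Next Obligation. by move=> x y z g f; exact: dual_map_comp. Qed.

Program Definition boundary_functor : functor Intervals Sets2_pt :=
  @Functor _ _ boundary_data _ _.
Next Obligation. by move=> n; exact: pair_map_eq. Qed.
Next Obligation. by move=> n m l g f; exact: pair_map_eq. Qed.

Lemma smash_pair_map_id (P : pointed_pair) (B : pointedType) :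
  smash_pair_map (idm (P : obj Sets2_pt)) (pmap_id B)
  = idm (smash_pair P B : obj Sets2_pt).
Proof.
apply: pair_map_eq => z /=; rewrite -[z]reprK [LHS]smash_funE /=.
by case: (repr z).
Qed.

(** Functoriality in both arguments jointly; taking identities for some of the
    four maps gives functoriality in each of them as well as their
    commutation. *)
Lemma smash_pair_map_comp (P Q S : pointed_pair) (A B C : pointedType)
    (f' : pair_map Q S) (f : pair_map P Q) (g' : Defs.pmap B C) (g : Defs.pmap A B) :
  smash_pair_map (compm (c := Sets2_pt) f' f) (pmap_comp g' g)
  = compm (c := Sets2_pt) (smash_pair_map f' g') (smash_pair_map f g).
Proof.
apply: pair_map_eq => z /=; rewrite -[z]reprK [LHS]smash_funE /=.
by rewrite (smash_funE f g) smash_funE.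
Qed.

Program Definition smash_functor (P : pointed_pair) : functor Gamma_op Sets2_pt :=
  @Functor _ _ (gamma_data P) _ _.
Next Obligation. by move=> P k; exact: smash_pair_map_id. Qed.
Next Obligation.
move=> P k l m g f; apply: etrans (smash_pair_map_comp _ _ _ _).
by congr smash_pair_map; exact: pair_map_eq.
Qed.

Lemma smash_trivial (P : pointed_pair) (z : smash P (kplus 0)) : z = point.
Proof.
rewrite -[z]reprK; apply/smash_piP; rewrite /smash_rel /in_wedge !eqxx /=.
by rewrite [X in X == point :> kplus 0]ord1 eqxx !orbT.
Qed.

(** * The Gamma-space of a functor on pairs *)

Definition preserves_trivial (K : functor Sets2_pt Sets_pt) :=
  forall P : pointed_pair, (forall x : P, x = point) ->
  forall u : (K P : pointedType), u = point.

Section GammaSpaceOf.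
Variables (K : functor Sets2_pt Sets_pt) (K_trivial : preserves_trivial K).

Definition smash_smodule (P : pointed_pair) : smodule :=
  @SModule (fcomp K (smash_functor P))
    (K_trivial (P := smash_pair P (kplus 0)) (@smash_trivial P)).

Program Definition smash_smodule_map (P Q : pointed_pair) (f : pair_map P Q) :
    nat_trans (smash_smodule P : functor _ _) (smash_smodule Q : functor _ _) :=
  @NatTrans Gamma_op Sets_pt _ _
    (fun k => fmor K
       (smash_pair_map f (pmap_id (kplus k)) : Defs.hom (c := Sets2_pt) _ _)) _.
Next Obligation.
move=> P Q f k l g; apply: etrans (esym (fmorM K _ _)) _.
apply: etrans (fmorM K _ _); congr (fmor K).
apply: etrans (esym (smash_pair_map_comp _ _ _ _)) _.
apply: etrans (smash_pair_map_comp _ _ _ _).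
by congr smash_pair_map; [exact: pair_map_eq|exact: pmapP].
Qed.

Program Definition smash_smodule_functor : functor Sets2_pt SMod :=
  @Functor Sets2_pt SMod
    (@FunctorData Sets2_pt SMod smash_smodule smash_smodule_map) _ _.
Next Obligation.
move=> P; apply: nat_transP => k; apply: etrans (fmor1 K _).
by congr (fmor K); exact: smash_pair_map_id.
Qed.
Next Obligation.
move=> P Q S g f; apply: nat_transP => k; apply: etrans (fmorM K _ _).
congr (fmor K); apply: etrans (smash_pair_map_comp _ _ _ _).
by congr smash_pair_map; exact: pmapP.
Qed.

Definition Gamma_space_of : obj Gamma_spaces :=
  fcomp smash_smodule_functor (fcomp boundary_functor dual_functor).

End GammaSpaceOf.

Section GammaSpaceOfMap.
Variables (K K' : functor Sets2_pt Sets_pt).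
Hypotheses (K_trivial : preserves_trivial K) (K'_trivial : preserves_trivial K').

Program Definition Gamma_space_of_map (a : nat_trans K K') :
    Defs.hom (c := Gamma_spaces)
      (Gamma_space_of K_trivial) (Gamma_space_of K'_trivial) :=
  @NatTrans (op Delta) SMod _ _
    (fun n => @NatTrans Gamma_op Sets_pt _ _
       (fun k => a (smash_pair (boundary_pair n) (kplus k))) _) _.
Next Obligation.
move=> a n k l g.
exact: (ntP a (smash_pair_map _ _ : Defs.hom (c := Sets2_pt) _ _)).
Qed.
Next Obligation.
move=> a n m f; apply: nat_transP => k.
exact: (ntP a (smash_pair_map _ _ : Defs.hom (c := Sets2_pt) _ _)).
Qed.

End GammaSpaceOfMap.

Lemma isomorphic_Gamma_space_of (K K' : functor Sets2_pt Sets_pt)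
    (K_trivial : preserves_trivial K) (K'_trivial : preserves_trivial K') :
  isomorphic (C := functor_cat _ _) K K' ->
  isomorphic (Gamma_space_of K_trivial) (Gamma_space_of K'_trivial).
Proof.
move=> [a [b [ba ab]]].
exists (Gamma_space_of_map K_trivial K'_trivial a).
exists (Gamma_space_of_map K'_trivial K_trivial b).
split; apply: nat_transP => n; apply: nat_transP => k.
- exact: (congr1 (fun c : nat_trans K K => c _) ba).
- exact: (congr1 (fun c : nat_trans K' K' => c _) ab).
Qed.

(** * Functoriality of K_{L,lambda} *)

Section Hphi_functoriality.
Variables (R : realType) (L : zmodClosed R).

Lemma phi_is_zmod_morphism : zmod_morphism (phi L).
Proof. by move=> x y; rewrite /phi raddfB. Qed.

HB.instance Definition _ :=
  GRing.isZmodMorphism.Build R (RmodL L) (phi L) phi_is_zmod_morphism.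

Lemma phi_eq (x y : R) : (phi L x == phi L y) = (x - y \in L).
Proof. by rewrite Quotient.idealrBE. Qed.

Lemma phi_repr (u : RmodL L) : u = phi L (repr u).
Proof. by rewrite /phi reprK. Qed.

Lemma to_mod_fin (P : pointed_pair) (psi : Hphi_fun L P) :
  finite_set [set x | to_mod psi x != 0].
Proof.
apply: (@sub_finite_set _ _
  ([set x | realpart psi x != 0] `|` [set x | modpart psi x != 0])).
  move=> x /=; rewrite /to_mod; case: ifP => _; first by right.
  by move=> h; left; apply: contraNneq h => ->; rewrite /phi raddf0.
by rewrite finite_setU; split; [exact: realpart_fin|exact: modpart_fin].
Qed.

(** The uniform description of the pushforward modulo L.  Above y outside Y' the
    fibre avoids Y, so the sum of the images of the real values is the image of
    their sum; above y in Y' the base point contributes nothing, as it lies over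
    the base point. *)
Lemma to_mod_push (P Q : pointed_pair) (f : pair_map P Q) (psi : Hphi_fun L P) y :
  y <> point ->
  to_mod (Hphi_push f psi) y = \sum_(x \in [set x | f x = y]) to_mod psi x.
Proof.
move=> y0; rewrite /to_mod /= /push_real /push_mod.
have fE : [set x | x <> point /\ f x = y] = [set x | f x = y].
  apply/seteqP; split=> x /= [] // fxy; split=> // x0.
  by apply: y0; rewrite -fxy x0 pfunP.
case: ifPn => [/asboolP Yy|/asboolPn Yy].
  by rewrite asboolT // fE.
rewrite asboolF // raddf_fsum; last exact: realpart_fin.
apply: eq_fsbigr => x; rewrite inE /= => fxy.
by rewrite asboolF // => /(pair_mapP f); rewrite fxy.
Qed.

Lemma Hphi_push_id (P : pointed_pair) (psi : Hphi_fun L P) :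
  Hphi_push (idm (P : obj Sets2_pt)) psi = psi.
Proof.
have E y : [set x | pmap_of (idm (P : obj Sets2_pt)) x = y] = [set y] by [].
apply: Hphi_fun_eq => y /=; rewrite ?/push_real ?/push_mod; case: asboolP => Yy.
- by rewrite realpart_out.
- by rewrite E fsbig_set1.
- rewrite (_ : [set x | _] = [set y]) ?fsbig_set1 ?/to_mod ?asboolT //.
    by case: Yy.
  by apply/seteqP; split=> x /= => [[]//|->]; case: Yy.
- by rewrite modpart_out.
Qed.

Lemma Hphi_push_comp (P Q S : pointed_pair) (g : pair_map Q S) (f : pair_map P Q)
    (psi : Hphi_fun L P) :
  Hphi_push (compm (c := Sets2_pt) g f) psi = Hphi_push g (Hphi_push f psi).
Proof.
apply: Hphi_fun_eq => y /=; rewrite /push_real /push_mod; case: asboolP => // Yy.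
  rewrite -(@fsum_fsum_fiber _ _ _ f _ [set z | g z = y]); last exact: realpart_fin.
  apply: eq_fsbigr => z; rewrite inE /= => gzy; rewrite /push_real asboolF //.
  by move=> /(pair_mapP g); rewrite gzy.
have [_ y0] := Yy.
have neq0 (T : pointed_pair) (h : pair_map T S) x : h x = y -> x <> point.
  by move=> hxy x0; apply: y0; rewrite -hxy x0 pfunP.
have E (T : pointed_pair) (h : pair_map T S) :
    [set x | x <> point /\ h x = y] = [set x | h x = y].
  by apply/seteqP; split=> x /= [] // hxy; split=> //; exact: neq0 hxy.
rewrite !E -(@fsum_fsum_fiber _ _ _ f _ [set z | g z = y]); last exact: to_mod_fin.
apply: eq_fsbigr => z; rewrite inE /= => gzy.
by rewrite to_mod_push //; exact: neq0 gzy.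
Qed.

Variable lam : {nonneg R}.

Program Definition KL_functor : functor Sets2_pt Sets_pt :=
  @Functor Sets2_pt Sets_pt (KL_data L lam) _ _.
Next Obligation.
by move=> P; apply: pmapP => psi; apply: val_inj; exact: Hphi_push_id.
Qed.
Next Obligation.
by move=> P Q S g f; apply: pmapP => psi; apply: val_inj; exact: Hphi_push_comp.
Qed.

Lemma KL_trivial : preserves_trivial KL_functor.
Proof.
move=> P P1 u; apply: val_inj; apply: Hphi_fun_eq => x /=; rewrite (P1 x).
  by apply: realpart_out; exact: psub_point.
by apply: modpart_out => -[].
Qed.

End Hphi_functoriality.

(** * Homotheties *)

Section Scaling.
Variables (R : realType) (L L' : zmodClosed R) (c : R).
Hypothesis cL : forall x, x \in L -> c * x \in L'.

(** The map R/L -> R/L' induced by multiplication by c, defined on arbitrary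
    representatives; [scale_mod_phi] is its independence of their choice. *)
Definition scale_mod (u : RmodL L) : RmodL L' := phi L' (c * repr u).

Lemma scale_mod_phi x : scale_mod (phi L x) = phi L' (c * x).
Proof.
apply/eqP; rewrite phi_eq -mulrBr; apply: cL.
by rewrite -phi_eq -phi_repr.
Qed.

Lemma scale_mod_is_zmod_morphism : zmod_morphism scale_mod.
Proof.
move=> u v; rewrite [u]phi_repr [v]phi_repr -raddfB !scale_mod_phi.
by rewrite mulrBr raddfB.
Qed.

HB.instance Definition _ :=
  GRing.isZmodMorphism.Build (RmodL L) (RmodL L') scale_mod
    scale_mod_is_zmod_morphism.

Program Definition Hphi_scale (P : pointed_pair) (psi : Hphi_fun L P) :
    Hphi_fun L' P :=
  @HphiFun R L' P (fun x => c * realpart psi x)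
    (fun x => scale_mod (modpart psi x)) _ _ _ _.
Next Obligation. by move=> P psi x Yx /=; rewrite realpart_out // mulr0. Qed.
Next Obligation. by move=> P psi x Yx /=; rewrite modpart_out // raddf0. Qed.
Next Obligation.
move=> P psi; apply: sub_finite_set (realpart_fin psi) => x /=.
by apply: contraNneq => ->; rewrite mulr0.
Qed.
Next Obligation.
move=> P psi; apply: sub_finite_set (modpart_fin psi) => x /=.
by apply: contraNneq => ->; rewrite raddf0.
Qed.

Lemma to_mod_scale (P : pointed_pair) (psi : Hphi_fun L P) x :
  to_mod (Hphi_scale psi) x = scale_mod (to_mod psi x).
Proof. by rewrite /to_mod /=; case: ifP => // _; rewrite scale_mod_phi. Qed.

Lemma Hphi_scale_push (P Q : pointed_pair) (f : pair_map P Q) (psi : Hphi_fun L P) :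
  Hphi_scale (Hphi_push f psi) = Hphi_push f (Hphi_scale psi).
Proof.
apply: Hphi_fun_eq => y /=; rewrite ?/push_real ?/push_mod.
  by case: ifP => _; rewrite ?mulr0 // mulr_fsumr.
case: ifP => _; last by rewrite raddf0.
rewrite raddf_fsum; last exact: to_mod_fin.
by apply: eq_fsbigr => x _; rewrite to_mod_scale.
Qed.

Lemma Hphi_norm_scale (P : pointed_pair) (psi : Hphi_fun L P) :
  Hphi_norm (Hphi_scale psi) = `|c| * Hphi_norm psi.
Proof.
by rewrite /Hphi_norm mulr_fsumr; apply: eq_fsbigr => x _; rewrite /= normrM.
Qed.

Variables lam lam' : {nonneg R}.
Hypothesis clam : `|c| * lam%:num <= lam'%:num.

Program Definition KL_scale_fun (P : pointed_pair) (psi : KL_fun L lam P) :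
  KL_fun L' lam' P := exist _ (Hphi_scale (val psi)) _.
Next Obligation.
move=> P [psi /= psi_lam]; rewrite Hphi_norm_scale.
by apply: le_trans clam; rewrite ler_wpM2l.
Qed.

Program Definition KL_scale (P : pointed_pair) :
    Defs.pmap (KL_fun L lam P) (KL_fun L' lam' P) :=
  @PMap _ _ (@KL_scale_fun P) _.
Next Obligation.
move=> P; apply: val_inj; apply: Hphi_fun_eq => x /=; first by rewrite mulr0.
by rewrite raddf0.
Qed.

Program Definition KL_scale_trans :
    nat_trans (KL_functor L lam) (KL_functor L' lam') :=
  @NatTrans Sets2_pt Sets_pt _ _ KL_scale _.
Next Obligation.
by move=> P Q f; apply: pmapP => psi; apply: val_inj; exact: Hphi_scale_push.
Qed.

End Scaling.

Lemma KL_scaleK (R : realType) (L L' : zmodClosed R) (c d : R)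
    (cL : forall x, x \in L -> c * x \in L') (dL : forall x, x \in L' -> d * x \in L)
    (lam lam' : {nonneg R}) (clam : `|c| * lam%:num <= lam'%:num)
    (dlam : `|d| * lam'%:num <= lam%:num) : d * c = 1 ->
  compm (c := functor_cat _ _) (KL_scale_trans dL dlam) (KL_scale_trans cL clam)
  = idm (KL_functor L lam : obj (functor_cat _ _)).
Proof.
move=> dc; apply: nat_transP => P; apply: pmapP => psi; apply: val_inj.
apply: Hphi_fun_eq => x /=; first by rewrite mulrA dc mul1r.
by rewrite [modpart _ x]phi_repr !scale_mod_phi // mulrA dc mul1r.
Qed.

(** The hypothesis on L and L' says L' = cL; then c and c^-1 both preserve the
    bounds on the norm, and induce inverse isomorphisms. *)
Lemma isomorphic_KL_functor (R : realType) (L L' : zmodClosed R) (c : R)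
    (lam lam' : {nonneg R}) : 0 < c ->
  (forall x, (c * x \in L') = (x \in L)) -> c * lam%:num = lam'%:num ->
  isomorphic (C := functor_cat _ _) (KL_functor L lam) (KL_functor L' lam').
Proof.
move=> c0 LL' clam.
have cL x : x \in L -> c * x \in L' by rewrite LL'.
have dL x : x \in L' -> c^-1 * x \in L by rewrite -LL' mulVKf ?gt_eqF.
have clam_le : `|c| * lam%:num <= lam'%:num by rewrite gtr0_norm // clam.
have dlam_le : `|c^-1| * lam'%:num <= lam%:num.
  by rewrite gtr0_norm ?invr_gt0 // -clam mulKf ?gt_eqF.
exists (KL_scale_trans cL clam_le), (KL_scale_trans dL dlam_le).
by split; apply: KL_scaleK; rewrite ?mulVf ?mulfV ?gt_eqF.
Qed.

(** * Valuations and principal divisors *)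

Lemma vpM (p : prime_nat) (q r : rat) : q != 0 -> r != 0 ->
  vp p (q * r) = vp p q + vp p r.
Proof.
move=> q0 r0; rewrite -[in LHS](divq_num_den q) -[in LHS](divq_num_den r).
rewrite mulf_div -!intrM vp_frac ?mulf_neq0 ?numq_eq0 ?denq_neq0 //.
rewrite !abszM !lognM ?absz_gt0 ?numq_eq0 ?denq_neq0 // /vp; lia.
Qed.

(** Without this, the sum over all primes defining a principal divisor would have
    the default value 0. *)
Lemma vp_finite (q : rat) : finite_set [set p | vp p q != 0].
Proof.
set s := primes `|numq q| ++ primes `|denq q|.
have sfin : finite_set ((fun p : prime_nat => val p) @^-1` [set` s]).
  by apply: finite_preimage (finite_seq s) => p p' _ _; exact: val_inj.
apply: sub_finite_set sfin => p /=.
rewrite mem_cat -!logn_gt0 /vp; case: (logn _ _) => [|n] //.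
by case: (logn _ _).
Qed.

Lemma coeff_principal (p : prime_nat) (q : rat) :
  coeff p (\sum_(p' \in [set: prime_nat]) << vp p' q *g p' >>) = vp p q.
Proof.
rewrite raddf_fsum; last first.
  apply: sub_finite_set (vp_finite q) => p' /=.
  by apply: contraNneq => ->; rewrite freegU0.
rewrite (fsbigE [:: p]) //=.
  by rewrite big_cons big_nil ifT ?inE // addr0 coeffU eqxx mulr1.
move=> p' _; rewrite inE => p'p.
by rewrite coeffU (negPf p'p) mulr0.
Qed.

Lemma H0_finite_add_principal (R : realType) (D : arakelov_divisor R) (q r : rat) :
  q != 0 -> H0_finite (D + principal_divisor R q).1 r <-> H0_finite D.1 (q * r).
Proof.
move=> q0; rewrite /H0_finite /=; split=> H p; move: (H p);
  rewrite !padic_abs_leP mulf_eq0 (negPf q0) /= coeffD coeff_principal;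
  have [//|r0] /= := eqVneq r 0; rewrite vpM //; lia.
Qed.

Lemma Lsub_add_principal (R : realType) (D : arakelov_divisor R) (q : rat) (x : R) :
  q != 0 ->
  ((ratr q)^-1 * x \in Lsub R (D + principal_divisor R q).1) = (x \in Lsub R D.1).
Proof.
move=> q0; have Rq0 : ratr q != 0 :> R by rewrite fmorph_eq0.
apply/asboolP/asboolP => -[r Hr].
  move=> /(canRL (mulKf _)); rewrite invr_eq0 invrK => /(_ Rq0) ->.
  exists (q * r); last by rewrite rmorphM.
  exact/H0_finite_add_principal.
move=> ->; exists (q^-1 * r); last by rewrite rmorphM fmorphV.
by apply/H0_finite_add_principal => //; rewrite mulVKf.
Qed.

Theorem proposition4p9 (R : realType) :
  exists H : arakelov_divisor R -> obj Gamma_spaces,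
    (forall D : arakelov_divisor R, Gamma_space_data (H D) = HD_data D) /\
    (forall D D' : arakelov_divisor R,
       linearly_equivalent D D' -> isomorphic (H D) (H D')).
Proof.
exists (fun D => Gamma_space_of (@KL_trivial R (Lsub R D.1) (expR D.2)%:nng)).
split=> [//|D _ [q q0 ->]]; apply: isomorphic_Gamma_space_of.
have Rq0 : 0 < ratr q :> R by rewrite ltr0q.
apply: (@isomorphic_KL_functor _ _ _ (ratr q)^-1); first by rewrite invr_gt0.
  by move=> x; apply: Lsub_add_principal; rewrite gt_eqF.
by rewrite /= expRD expRN lnK // mulrC.
Qed.
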